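(* Let $q\in\mathbb{R}$, $k\in\mathbb{N}$ with $k\ge 1$, $c\in\mathbb{R}$ and $x_1,\dots,x_k\in\mathbb{R}$ with $1+(1-q)(-x_i+c)>0$ for all $i$. Suppose that the frequencies $n_i\in\mathbb{N}$ of the data $x_i$ are given by $$n_i=\exp_q(-x_i+c)\qquad(i=1,\dots,k),$$ and set $n:=\sum_{i=1}^k n_i$ and $p_i:=n_i/n$. Then for every $i=1,\dots,k$, $$\ln_q p_i=-n^{q-1}x_i+\left(n^{q-1}c-\ln_{2-q}n\right).$$
   Context: For $s\in\mathbb{R}$ and $y>0$, the $s$-logarithm is $\ln_s y:=\int_1^y v^{-s}\,dv$, which equals $\frac{y^{1-s}-1}{1-s}$ if $s\ne1$ and $\ln y$ if $s=1$. For $q\neq1$, the $q$-exponential is $\exp_q(x):=[1+(1-q)x]^{\frac{1}{1-q}}$ for $1+(1-q)x>0$, the inverse function of $\ln_q$; for $q=1$, $\exp_1(x):=e^x$. *)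

(* Defs.v *)
From Stdlib Require Import Reals.
From Coquelicot Require Import Coquelicot.

Open Scope R_scope.

(* [RInt] is the oriented integral, so [ln_s s y <= 0] for [0 < y <= 1].
   Only meaningful for [0 < y]. *)
Definition ln_s (s y : R) : R := RInt (fun v : R => Rpower v (- s)) 1 y.

(* Only meaningful for [0 < 1 + (1 - q) * x], which always holds when
   [q = 1]. *)
Definition exp_q (q x : R) : R :=
  if Req_EM_T q 1 then exp x
  else Rpower (1 + (1 - q) * x) (1 / (1 - q)).

(* Main.v *)
Require Import Defs.
From Stdlib Require Import Reals.
From Coquelicot Require Import Coquelicot.
From Stdlib Require Import Lra Lia.

Open Scope R_scope.

(** The value of the total [n] is irrelevant beyond [0 < n]: [ln_s_exp_q_div] treats any positive
    divisor, and the theorem is the case [z = - x i + c]. For [q <> 1], raising [exp_q q z / n] to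
    the power [1 - q] undoes the q-exponential and gives [n^(q-1) * (1 + (1-q) * z)]. Subtracting 1
    and dividing by [1 - q] leaves [n^(q-1) * z + (n^(q-1) - 1) / (1 - q)], whose last term is
    [- ln_s (2 - q) n] because [1 - (2 - q) = q - 1]. For [q = 1] this is the ordinary quotient rule
    for [ln]. *)

Lemma ln_s_primitive (s : R) (F : R -> R) (y : R) :
  0 < y ->
  (forall v : R, 0 < v -> is_derive F v (Rpower v (- s))) ->
  ln_s s y = F y - F 1.
Proof.
  intros hy hF.
  (* Since [y] may lie on either side of 1, the interval is given by [Rmin] and [Rmax]; it stays
     away from 0 in both cases. *)
  assert (hpos : forall v, Rmin 1 y <= v <= Rmax 1 y -> 0 < v).
  { intros v [hv _].
    apply Rlt_le_trans with (2 := hv).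
    apply Rmin_glb_lt; lra. }
  apply is_RInt_unique.
  apply (is_RInt_derive F (fun v => Rpower v (- s))); intros v hv.
  - apply hF, hpos, hv.
  - apply (ex_derive_continuous (V := R_NormedModule)).
    unfold Rpower; auto_derive.
    apply hpos, hv.
Qed.

Lemma ln_s_1 (y : R) : 0 < y -> ln_s 1 y = ln y.
Proof.
  intros hy.
  rewrite (ln_s_primitive 1 ln y hy), ln_1; [ring|].
  intros v hv.
  rewrite Rpower_Ropp, Rpower_1 by exact hv.
  auto_derive; [exact hv | field; lra].
Qed.

Lemma ln_s_neq_1 (s y : R) :
  s <> 1 -> 0 < y -> ln_s s y = (Rpower y (1 - s) - 1) / (1 - s).
Proof.
  intros hs hy.
  rewrite (ln_s_primitive s (fun v => Rpower v (1 - s) / (1 - s)) y hy).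
  - unfold Rpower at 2.
    rewrite ln_1, Rmult_0_r, exp_0.
    field; lra.
  - intros v hv.
    (* Differentiating [exp ((1 - s) * ln v)] yields a factor [/ v], so the integrand is put in that
       shape. *)
    replace (Rpower v (- s)) with (Rpower v (1 - s) / v).
    + unfold Rpower; auto_derive; [exact hv | field; lra].
    + replace (- s) with ((1 - s) + - (1)) by ring.
      rewrite Rpower_plus, Rpower_Ropp, Rpower_1 by exact hv.
      reflexivity.
Qed.

Lemma ln_exp_q_1 (x : R) : ln (exp_q 1 x) = x.
Proof.
  unfold exp_q.
  destruct (Req_EM_T 1 1) as [_|h]; [apply ln_exp | now contradict h].
Qed.

Lemma Rpower_exp_q (q x : R) :
  q <> 1 -> 0 < 1 + (1 - q) * x ->
  Rpower (exp_q q x) (1 - q) = 1 + (1 - q) * x.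
Proof.
  intros hq hx.
  unfold exp_q.
  destruct (Req_EM_T q 1) as [h|_]; [now contradict h|].
  rewrite Rpower_mult.
  replace (1 / (1 - q) * (1 - q)) with 1 by (field; lra).
  apply Rpower_1, hx.
Qed.

(** No domain condition arises, as [Rpower] is by definition a value of [exp]. *)
Lemma exp_q_pos (q x : R) : 0 < exp_q q x.
Proof.
  unfold exp_q, Rpower.
  destruct (Req_EM_T q 1); apply exp_pos.
Qed.

Lemma sum_n_m_pos (a : nat -> R) (m n : nat) :
  (m <= n)%nat -> (forall i : nat, (m <= i <= n)%nat -> 0 < a i) ->
  0 < sum_n_m a m n.
Proof.
  intros hmn.
  induction hmn as [|n hmn IH]; intros ha.
  - rewrite sum_n_n; apply ha; lia.
  - rewrite sum_n_Sm by lia.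
    apply Rplus_lt_0_compat; [apply IH; intros i hi|]; apply ha; lia.
Qed.

Lemma ln_s_exp_q_div (q n z : R) :
  0 < n -> 0 < 1 + (1 - q) * z ->
  ln_s q (exp_q q z / n) = Rpower n (q - 1) * z - ln_s (2 - q) n.
Proof.
  intros hn hz.
  assert (hp := Rdiv_lt_0_compat _ _ (exp_q_pos q z) hn).
  destruct (Req_dec q 1) as [->|hq].
  (* At [q = 1] the dual index [2 - q] is also 1, so both logarithms are [ln], and [n^(q-1)] is
     1. *)
  - replace (2 - 1) with 1 by ring.
    rewrite !ln_s_1, ln_div, ln_exp_q_1 by auto using exp_q_pos.
    rewrite Rminus_diag, Rpower_O by exact hn.
    ring.
  - rewrite !ln_s_neq_1 by (auto; lra).
    assert (hN : Rpower (exp_q q z / n) (1 - q)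
                 = Rpower n (q - 1) * (1 + (1 - q) * z)).
    { rewrite <- (Rpower_exp_q q z hq hz).
      unfold Rpower.
      rewrite <- exp_plus, ln_div by auto using exp_q_pos.
      f_equal; ring. }
    rewrite hN.
    replace (1 - (2 - q)) with (q - 1) by ring.
    field; lra.
Qed.

Theorem mainTheorem3 (q : R) (k : nat) (hk : (1 <= k)%nat) (c : R)
    (x : nat -> R)
    (hdom : forall i : nat, (1 <= i <= k)%nat -> 0 < 1 + (1 - q) * (- x i + c))
    (f : nat -> nat)
    (hf : forall i : nat, (1 <= i <= k)%nat -> INR (f i) = exp_q q (- x i + c)) :
  let n : R := sum_n_m (fun i : nat => INR (f i)) 1 k in
  let p : nat -> R := fun i : nat => INR (f i) / n in
  forall i : nat, (1 <= i <= k)%nat ->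
    ln_s q (p i) =
      - Rpower n (q - 1) * x i + (Rpower n (q - 1) * c - ln_s (2 - q) n).
Proof.
  intros n p i hi.
  (* [k >= 1] makes the sum nonempty, and each frequency is positive as a value of [exp_q]. *)
  assert (hn : 0 < n).
  { apply sum_n_m_pos; [exact hk|].
    intros j hj; rewrite hf by exact hj; apply exp_q_pos. }
  unfold p.
  rewrite hf, ln_s_exp_q_div by auto.
  ring.
Qed.
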